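(* Let $m\ge n\ge 2$, let $K_1\subset\mathbb{R}^n$ and $K_2\subset\mathbb{R}^m$ be proper cones, and let $L(A) = XAY$ be a linear map on $M_{m,n}$, where $X \in M_m$ and $Y \in M_n$ are fixed. Then $L(S(K_1,K_2)) = S(K_1,K_2)$ if and only if either $X(K_2)=K_2$ and $Y(K_1)=K_1$, or $-X(K_2)=K_2$ and $-Y(K_1)=K_1$.
   Context: $M_{m,n}$ is the space of real $m\times n$ matrices and $M_n = M_{n,n}$. A convex cone $K\subseteq\mathbb{R}^n$ is a set with $K+K\subseteq K$ and $\alpha K\subseteq K$ for all $\alpha\ge 0$; it is proper if it is closed, pointed ($K\cap -K=\{0\}$) and has nonempty interior $K^\circ$. A matrix $A\in M_{m,n}$ is $(K_1,K_2)$-semipositive if there exists $x\in K_1^\circ$ with $Ax\in K_2^\circ$; the set of such matrices is $S(K_1,K_2)$. *)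

(* Defs.v *)
From HB Require Import structures.
From mathcomp Require Import all_boot all_order all_algebra.
From mathcomp Require Import all_classical all_reals.
From mathcomp Require Import topology normedtype.

Set Implicit Arguments.
Unset Strict Implicit.
Unset Printing Implicit Defensive.

Import Order.TTheory GRing.Theory Num.Theory.
Import numFieldNormedType.Exports.

Local Open Scope classical_set_scope.
Local Open Scope ring_scope.

(* Vectors of R^n are column vectors, with the product topology on matrices. *)

Definition convex_cone (R : realType) (n : nat) (K : set 'cV[R]_n) : Prop :=
  (forall x y, K x -> K y -> K (x + y)) /\
  (forall (a : R) x, 0 <= a -> K x -> K (a *: x)).

Definition proper_cone (R : realType) (n : nat) (K : set 'cV[R]_n) : Prop :=
  [/\ convex_cone K, closed K, K `&` -%R @` K = [set 0] & interior K !=set0].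

Definition semipositive (R : realType) (m n : nat)
    (K1 : set 'cV[R]_n) (K2 : set 'cV[R]_m) : set 'M[R]_(m, n) :=
  [set A | exists2 x, interior K1 x & interior K2 (A *m x)].

(* Main.v *)
Require Import Defs.
From HB Require Import structures.
From mathcomp Require Import all_boot all_order all_algebra.
From mathcomp Require Import all_classical all_reals.
From mathcomp Require Import topology normedtype derive.
From mathcomp Require Import ring lra.

Set Implicit Arguments.
Unset Strict Implicit.
Unset Printing Implicit Defensive.

Import Order.TTheory GRing.Theory Num.Theory.
Import numFieldNormedType.Exports.

Local Open Scope classical_set_scope.
Local Open Scope ring_scope.

(** Everything is read off from rank-one matrices.  For a column [u] and a row
    [v], the matrix [u *m v] sends [x] to the multiple [v x] of [u], so it is
    semipositive exactly when [u] is interior to [K2] and [v] is positive at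
    some interior point of [K1], or [- u] and [- v] have these properties
    ([rank1_semipositive], [semipositive_rank1]).  The map [A |-> X A Y] sends
    [u *m v] to the rank-one matrix [(X u) *m (v Y)].

    Suppose that the map carries the semipositive matrices onto themselves.
    Rank-one matrices inside its range force [X] and [Y] to be invertible
    ([preserver_unit]), so that it preserves semipositivity in both
    directions.  For interior [u] the image of [u *m v] shows that [X u] or
    [- X u] is interior to [K2]; the interior is convex, a segment is connected
    and a proper cone is disjoint from the interior of its opposite, so the sign
    is the same for all [u] ([preserver_sign]).  Replacing [(X, Y)] by
    [(- X, - Y)] leaves the map unchanged, so the sign may be taken positive;
    this is where the two alternatives of the theorem come from.  Then the
    same argument for the inverse map gives [X K2 = K2].  Now fix an interior
    [u]: the image of [u *m v] tells that [v Y] is positive somewhere on the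
    interior of [K1] whenever [v] is.  If [Y k] were in [K1] for some [k]
    outside the closed cone [K1], a functional [w] separating [k] from [K1]
    would make [v := w Y^-1] positive at [Y k] while [v Y = w] is nowhere
    positive on [K1] ([preserver_reflects_cone]).  With the inverse map this
    gives [Y K1 = K1].

    Conversely a linear automorphism of a proper cone is invertible and
    permutes its interior, so witnesses of semipositivity are carried to
    witnesses ([automorphisms_preserve]).

    The separating functional comes from the nearest point of the cone
    ([cone_separation]), which exists by compactness. *)

(** * Continuity of matrix-valued maps *)

Lemma continuous_mx (T : topologicalType) (R : realType) (m n : nat)
    (F : T -> 'M[R]_(m, n)) :
  (forall i j, continuous (fun x => F x i j)) -> continuous F.
Proof.
move=> cF x B [P nP sB].
have h : \forall y \near x, forall i j, P i j (F y i j).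
  apply: filter_forall => i; apply: filter_forall => j.
  exact: (cF i j x) (nP i j).
by apply: filterS h => y hy; exact: sB.
Qed.

Lemma continuous_sum (T : topologicalType) (R : realType) (n : nat)
    (F : 'I_n -> T -> R) :
  (forall i, continuous (F i)) -> continuous (fun x => \sum_i F i x).
Proof.
move=> cF; apply: (@continuous_big R 'I_n +%R 0 xpredT) => [|i _].
  exact: (@add_continuous R).
exact: cF.
Qed.

Lemma continuous_mulmx (R : realType) (m n p : nat) (A : 'M[R]_(m, n)) :
  continuous (fun x : 'M[R]_(n, p) => A *m x).
Proof.
apply: continuous_mx => i j.
rewrite (_ : (fun _ => _) = fun x : 'M[R]_(n, p) => \sum_k A i k * x k j);
  last by apply/funext => x; rewrite mxE.
apply: (continuous_sum (F := fun k (y : 'M[R]_(n, p)) => A i k * y k j)) => k y.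
exact: (cvgM (cvg_cst _) (@coord_continuous _ _ _ _ _ y)).
Qed.

Lemma continuous_trmx (R : realType) (m n : nat) :
  continuous (fun x : 'M[R]_(m, n) => x^T).
Proof.
apply: continuous_mx => i j.
rewrite (_ : (fun _ => _) = fun x : 'M[R]_(m, n) => x j i);
  last by apply/funext => x; rewrite mxE.
exact: coord_continuous.
Qed.

Lemma continuous_line (R : realType) (n : nat) (x d : 'cV[R]_n) :
  continuous (fun t : R => x + t *: d).
Proof.
move=> t; apply: (@cvgD _ _ _ (nbhs t) _ (fun=> x) (fun s => s *: d)).
  exact: cvg_cst.
exact: (cvgZr_tmp cvg_id).
Qed.

(** * Interior points of cones *)

(** All interior points below are obtained by pulling a known one back along a
    continuous map, usually a translation, a scaling or an inverse matrix. *)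
Lemma interior_continuous (R : realType) (n p : nat) (K : set 'cV[R]_n)
    (K' : set 'cV[R]_p) (g : 'cV[R]_p -> 'cV[R]_n) (y : 'cV[R]_p) :
  continuous g -> (forall z, K (g z) -> K' z) ->
  interior K (g y) -> interior K' y.
Proof.
by move=> cg KK' gyK; apply: (@filterS _ (nbhs y) _ (g @^-1` K)) => //; exact: cg.
Qed.

Lemma interior_line (R : realType) (n : nat) (K : set 'cV[R]_n)
    (x d : 'cV[R]_n) :
  interior K x ->
  exists2 e, 0 < e & forall t, `|t| < e -> interior K (x + t *: d).
Proof.
move=> xK.
have : nbhs (0 : R) ((fun t : R => x + t *: d) @^-1` interior K).
  apply: (@continuous_line _ _ x d 0); rewrite scale0r addr0.
  exact: nbhs_interior.
move=> /nbhs_ballP[e e0 he]; exists e => // t te; apply: he.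
by rewrite /ball /= sub0r normrN.
Qed.

Lemma interior_add (R : realType) (n : nat) (K : set 'cV[R]_n) (x k : 'cV[R]_n) :
  convex_cone K -> interior K x -> K k -> interior K (x + k).
Proof.
move=> [KD _] xK Kk.
apply: (@interior_continuous _ _ _ K K (fun y => y - k)).
- by move=> z; apply: (@cvgB _ _ _ (nbhs z) _ id (fun=> k)); [exact: cvg_id |
    exact: cvg_cst].
- by move=> z /KD /(_ Kk); rewrite subrK.
- by rewrite addrK.
Qed.

Lemma interior_scale (R : realType) (n : nat) (K : set 'cV[R]_n) (a : R)
    (x : 'cV[R]_n) :
  convex_cone K -> 0 < a -> interior K x -> interior K (a *: x).
Proof.
move=> [_ KZ] a0 xK.
apply: (@interior_continuous _ _ _ K K (fun y => a^-1 *: y)).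
- by move=> z; exact: (cvgZl_tmp cvg_id).
- move=> z /(KZ a _ (ltW a0)).
  by rewrite scalerA divff ?gt_eqF// scale1r.
- by rewrite scalerA mulVf ?gt_eqF// scale1r.
Qed.

(** If [0] were interior, both [t d] and [- t d] would lie in the cone for a
    nonzero [d] and a small [t], contradicting pointedness. *)
Lemma interior_neq0 (R : realType) (n : nat) (K : set 'cV[R]_n) :
  (0 < n)%N -> proper_cone K -> ~ interior K 0.
Proof.
move=> n0 [_ _ Kpt _] K0.
pose d : 'cV[R]_n := delta_mx (Ordinal n0) 0.
have [e e0 he] := interior_line d K0.
have h t : `|t| < e -> K (t *: d).
  by move=> /he; rewrite add0r => /interior_subset.
have e2 : `|e / 2| < e by rewrite ger0_norm; lra.
suff : (K `&` -%R @` K) ((e / 2) *: d).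
  rewrite Kpt /= => /eqP; rewrite scaler_eq0 => /orP[|/eqP/matrixP].
    by rewrite gt_eqF// divr_gt0.
  by move=> /(_ (Ordinal n0) 0) /eqP; rewrite !mxE !eqxx oner_eq0.
split; first exact: h.
by exists (- (e / 2) *: d); [apply: h; rewrite normrN | rewrite scaleNr opprK].
Qed.

Lemma interior_opp (R : realType) (n : nat) (K : set 'cV[R]_n) (x : 'cV[R]_n) :
  (0 < n)%N -> proper_cone K -> K x -> ~ interior K (- x).
Proof.
move=> n0 hK Kx Nx; apply: (interior_neq0 n0 hK); rewrite -(addNr x).
by apply: interior_add => //; case: hK.
Qed.

(** Moving a boundary point of the cone towards the interior and then letting
    the displacement tend to [0] passes from statements on the interior to
    statements on the cone. *)
Lemma closed_cone_line (R : realType) (n : nat) (K : set 'cV[R]_n)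
    (k u : 'cV[R]_n) :
  closed K -> (forall e, 0 < e -> K (k + e *: u)) -> K k.
Proof.
move=> Kc h; apply: Kc => B kB.
have : nbhs (0 : R) ((fun t : R => k + t *: u) @^-1` B).
  by apply: (@continuous_line _ _ k u 0); rewrite scale0r addr0.
move=> /nbhs_ballP[e /= e0 he].
have e2 : 0 < e / 2 by rewrite divr_gt0.
exists (k + (e / 2) *: u); split; first exact: h.
by apply: he; rewrite /ball /= sub0r normrN ger0_norm; lra.
Qed.

Lemma mulmx_cone_interior (R : realType) (n p : nat) (K : set 'cV[R]_n)
    (K' : set 'cV[R]_p) (P : 'M[R]_(p, n)) :
  proper_cone K -> closed K' ->
  (forall u, interior K u -> K' (P *m u)) -> forall k, K k -> K' (P *m k).
Proof.
move=> [Kc _ _ [u Ku]] K'c PK k Kk.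
apply: (@closed_cone_line _ _ _ _ (P *m u)) => // e e0.
rewrite scalemxAr -mulmxDr; apply: PK; rewrite addrC.
by apply: interior_add => //; exact: interior_scale.
Qed.

(** An open set lies in no hyperplane through the origin: from a zero of [r]
    one moves a little along a coordinate on which [r] does not vanish. *)
Lemma interior_functional (R : realType) (n : nat) (K : set 'cV[R]_n)
    (r : 'rV[R]_n) :
  interior K !=set0 -> r != 0 -> exists2 x, interior K x & (r *m x) 0 0 != 0.
Proof.
move=> [u Ku] r0.
have [ru|ru] := eqVneq ((r *m u) 0 0) 0; last by exists u.
have [j rj] : exists j, r 0 j != 0.
  apply/existsP; apply: contraNT r0 => /existsPn h.
  by apply/eqP/rowP => j; rewrite mxE; apply/eqP; have := h j; rewrite negbK.
have [e e0 he] := interior_line (delta_mx j 0) Ku.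
exists (u + (e / 2) *: delta_mx j 0).
  by apply: he; rewrite ger0_norm; lra.
rewrite mulmxDr -scalemxAr -colE !mxE in ru *.
by rewrite ru add0r mulf_neq0 // gt_eqF // divr_gt0.
Qed.

(** Along such a segment the points of [K] and of its interior coincide, because
    no point of [K] is interior to [- K].  The parameters of the points in the
    interior thus form an open and closed part of the connected interval. *)
Lemma segment_interior (R : realType) (n : nat) (K : set 'cV[R]_n)
    (x y : 'cV[R]_n) :
  (0 < n)%N -> proper_cone K ->
  (forall t, 0 <= t <= 1 ->
    interior K (x + t *: y) \/ interior K (- (x + t *: y))) ->
  interior K x -> interior K (x + y).
Proof.
move=> n0 hK hseg Kx; have [_ Kc _ _] := hK.
pose g t := x + t *: y; have cg : continuous g := @continuous_line _ _ x y.
have gI t : 0 <= t <= 1 -> K (g t) -> interior K (g t).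
  by move=> /hseg[//|gN] Kg; case: (interior_opp n0 hK Kg gN).
have : `[0, 1]%classic `&` g @^-1` interior K = `[0, 1]%classic.
  apply: (@segment_connected R 0 1).
  - by exists 0; split; rewrite /= ?in_itv/= ?lexx ?ler01 // /g scale0r addr0.
  - exists (g @^-1` interior K) => //.
    by apply: open_comp => //; exact: open_interior.
  - exists (g @^-1` K); first exact: closed_comp.
    apply/seteqP; split => t [] /=; rewrite in_itv/= => t01.
      by move=> /interior_subset.
    by split => //; exact: gI.
move=> /seteqP[_ /(_ 1)] /=; rewrite in_itv/= ler01 lexx => /(_ isT)[_].
by rewrite /g scale1r.
Qed.

(** * Separating a point from a closed convex cone *)

(** With [b < 0] the value at [s = - b / (c - b)] is [s (1 + s) b < 0]. *)
Lemma quadratic_ge0_slope (R : realType) (b c : R) :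
  0 <= c -> (forall s, 0 < s <= 1 -> 0 <= 2 * s * b + s ^+ 2 * c) -> 0 <= b.
Proof.
move=> c0 h; rewrite leNgt; apply/negP => b0.
have cb : 0 < c - b by lra.
pose s := - b / (c - b).
have s0 : 0 < s by rewrite divr_gt0 //; lra.
have s1 : s <= 1 by rewrite ler_pdivrMr //; lra.
have sE : s * (c - b) = - b by rewrite /s divfK ?gt_eqF.
have E : 2 * s * b + s ^+ 2 * c = s * (1 + s) * b.
  have -> : c = (c - b) + b by rewrite subrK.
  by rewrite mulrDr expr2 -(mulrA s) sE; ring.
have := h s; rewrite s0 s1 E => /(_ isT).
by rewrite leNgt nmulr_llt0 // mulr_gt0 //; lra.
Qed.

Definition dot (R : realType) (n : nat) (u v : 'cV[R]_n) : R := (u^T *m v) 0 0.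

Lemma dotE (R : realType) (n : nat) (u v : 'cV[R]_n) :
  dot u v = \sum_i u i 0 * v i 0.
Proof. by rewrite /dot mxE; apply: eq_bigr => i _; rewrite mxE. Qed.

Lemma dot_ge0 (R : realType) (n : nat) (u : 'cV[R]_n) : 0 <= dot u u.
Proof. by rewrite dotE; apply: sumr_ge0 => i _; rewrite -expr2 sqr_ge0. Qed.

Lemma dot_gt0 (R : realType) (n : nat) (u : 'cV[R]_n) : u != 0 -> 0 < dot u u.
Proof.
rewrite lt_def dot_ge0 andbT; apply: contraNneq.
rewrite dotE => /eqP; rewrite psumr_eq0 => [/allP h|i _]; last first.
  by rewrite -expr2 sqr_ge0.
apply/eqP/colP => i; rewrite mxE; apply/eqP.
by have := h i (mem_index_enum i); rewrite mulf_eq0 orbb.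
Qed.

Lemma dotDZ (R : realType) (n : nat) (s : R) (u v : 'cV[R]_n) :
  dot (u + s *: v) (u + s *: v) = dot u u + 2 * s * dot u v + s ^+ 2 * dot v v.
Proof.
rewrite !dotE !mulr_sumr -!big_split /=; apply: eq_bigr => i _.
by rewrite !mxE; ring.
Qed.

Lemma continuous_dist2 (R : realType) (n : nat) (w : 'cV[R]_n) :
  continuous (fun y : 'rV[R]_n => dot (y^T - w) (y^T - w)).
Proof.
rewrite (_ : (fun _ => _) =
    fun y : 'rV[R]_n => \sum_i (y^T - w) i 0 * (y^T - w) i 0);
  last by apply/funext => y; rewrite dotE.
apply: (continuous_sum
  (F := fun i (y : 'rV[R]_n) => (y^T - w) i 0 * (y^T - w) i 0)) => i y.
have h : {for y, continuous (fun y : 'rV[R]_n => (y^T - w) i 0)}.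
  rewrite (_ : (fun _ => _) = fun y : 'rV[R]_n => y 0 i - w i 0);
    last by apply/funext => z; rewrite !mxE.
  exact: (cvgB (@coord_continuous _ _ _ _ _ y) (cvg_cst _)).
exact: (continuousM h h).
Qed.

(** The points at least as close to [w] as the origin lie in the box with centre
    [w] and half-side [1 + |w|^2], so the minimum may be sought in a
    compact set. *)
Lemma nearest_point (R : realType) (n : nat) (K : set 'cV[R]_n) (w : 'cV[R]_n) :
  closed K -> K 0 ->
  exists2 p, K p & forall k, K k -> dot (p - w) (p - w) <= dot (k - w) (k - w).
Proof.
move=> Kc K0.
pose f (y : 'rV[R]_n) := dot (y^T - w) (y^T - w).
pose c := 1 + dot w w.
pose B := [set y : 'rV[R]_n |
  forall i, (`[w i 0 - c, w i 0 + c]%classic) (y ord0 i)].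
have inB y : f y <= dot w w -> B y.
  move=> fy i; rewrite /= in_itv /=.
  have : (y 0 i - w i 0) ^+ 2 <= f y.
    rewrite /f dotE (bigD1 i) //= !mxE -expr2 lerDl.
    by apply: sumr_ge0 => j _; rewrite -expr2 sqr_ge0.
  rewrite /c; have := dot_ge0 w; nra.
pose A := B `&` trmx @^-1` K.
have cA : compact A.
  apply: compact_closedI.
    exact: (rV_compact (fun i => @segment_compact R (w i 0 - c) (w i 0 + c))).
  by apply: closed_comp => // y _; exact: continuous_trmx.
have f0 : f 0 = dot w w.
  rewrite /f trmx0 sub0r !dotE; apply: eq_bigr => i _.
  by rewrite !mxE mulrNN.
(* The origin, which lies in the cone, shows that this compact set is nonempty. *)
have A0 : A 0 by split; rewrite /= ?trmx0//; apply: inB; rewrite f0.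
have [||y] := @compact_EVT_min _ R f A _ cA; first by exists 0.
  by apply: continuous_subspaceT; exact: continuous_dist2.
rewrite inE => -[_ Ky] ymin; exists y^T => // k Kk.
have [kw|kw] := leP (f k^T) (dot w w).
  have := ymin k^T; rewrite inE /f trmxK; apply.
  by split; rewrite /= ?trmxK//; exact: inB.
have := ymin 0; rewrite inE => /(_ A0); rewrite f0 => /le_trans; apply.
by rewrite ltW //; move: kw; rewrite /f trmxK.
Qed.

(** The functional is the inner product with [w - p], where [p] is the point of
    the cone nearest to [w].  Moving from [p] towards [p + k] cannot decrease the
    distance, so the functional is nonpositive on the cone; moving from [p]
    towards [0] cannot either, so it is nonnegative at [p] and hence positive at
    [w = p + (w - p)]. *)
Lemma cone_separation (R : realType) (n : nat) (K : set 'cV[R]_n)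
    (w : 'cV[R]_n) :
  convex_cone K -> closed K -> K 0 -> ~ K w ->
  exists2 v : 'rV[R]_n, 0 < (v *m w) 0 0 & forall k, K k -> (v *m k) 0 0 <= 0.
Proof.
move=> [KD KZ] Kc K0 Kw.
have [p Kp pmin] := nearest_point w Kc K0.
have slope d : (forall s, 0 < s <= 1 -> K (p + s *: d)) -> 0 <= dot (p - w) d.
  move=> hd; apply: (quadratic_ge0_slope (dot_ge0 d)) => s s01.
  by have := pmin _ (hd s s01); rewrite addrAC dotDZ -addrA lerDl.
have vE k : ((w - p)^T *m k) 0 0 = - dot (p - w) k.
  by rewrite -opprB linearN /= mulNmx mxE.
exists (w - p)^T => [|k Kk]; last first.
  rewrite vE oppr_le0; apply: slope => s /andP[s0 _].
  by apply: KD => //; apply: KZ => //; exact: ltW.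
have pw : 0 < dot (p - w) (p - w).
  by apply: dot_gt0; rewrite subr_eq0; apply: contra_notN Kw => /eqP <-.
(* Here [p + s (- p) = (1 - s) p] stays in the cone since [s <= 1]. *)
have pN : 0 <= dot (p - w) (- p).
  apply: slope => s /andP[_ s1].
  by rewrite scalerN -scaleNr -{1}(scale1r p) -scalerDl; apply: KZ => //; lra.
have E : - dot (p - w) w = dot (p - w) (p - w) + dot (p - w) (- p); last first.
  by rewrite vE E ltr_wpDr.
by rewrite !dotE -sumrN -big_split; apply: eq_bigr => i _ /=; rewrite !mxE; ring.
Qed.

(** * Rank-one semipositive matrices *)

Lemma rank1_mulmx (R : realType) (m n : nat) (u : 'cV[R]_m) (v : 'rV[R]_n)
    (x : 'cV[R]_n) :
  (u *m v) *m x = (v *m x) 0 0 *: u.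
Proof. by rewrite -mulmxA {1}[v *m x]mx11_scalar mul_mx_scalar. Qed.

Definition positive_somewhere (R : realType) (n : nat) (K : set 'cV[R]_n)
    (v : 'rV[R]_n) : Prop :=
  exists2 x, interior K x & 0 < (v *m x) 0 0.

Lemma rank1_semipositive (R : realType) (m n : nat) (K1 : set 'cV[R]_n)
    (K2 : set 'cV[R]_m) (u : 'cV[R]_m) (v : 'rV[R]_n) :
  proper_cone K2 -> interior K2 u -> positive_somewhere K1 v ->
  semipositive K1 K2 (u *m v).
Proof.
move=> [K2c _ _ _] K2u [x K1x vx]; exists x => //.
by rewrite rank1_mulmx; exact: interior_scale.
Qed.

Lemma semipositive_rank1 (R : realType) (m n : nat) (K1 : set 'cV[R]_n)
    (K2 : set 'cV[R]_m) (u : 'cV[R]_m) (v : 'rV[R]_n) :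
  (0 < m)%N -> proper_cone K2 -> semipositive K1 K2 (u *m v) ->
  (interior K2 u /\ positive_somewhere K1 v) \/ interior K2 (- u).
Proof.
move=> m0 hK2 [x K1x]; have [K2c _ _ _] := hK2.
rewrite rank1_mulmx; set a := (v *m x) 0 0.
have [a0|a0|<-] := ltgtP 0 a; last by rewrite scale0r => /(interior_neq0 m0 hK2).
  have ai : 0 < a^-1 by rewrite invr_gt0.
  move=> /(interior_scale K2c ai).
  by rewrite scalerA mulVf ?gt_eqF// scale1r; left; split=> //; exists x.
have ai : 0 < - a^-1 by rewrite oppr_gt0 invr_lt0.
move=> /(interior_scale K2c ai).
by rewrite scalerA mulNr mulVf ?lt_eqF// scaleN1r; right.
Qed.

Lemma positive_somewhere_sign (R : realType) (n : nat) (K : set 'cV[R]_n)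
    (v : 'rV[R]_n) :
  interior K !=set0 -> v != 0 ->
  positive_somewhere K v \/ positive_somewhere K (- v).
Proof.
move=> K0 /(interior_functional K0)[x Kx].
rewrite neq_lt => /orP[|] vx; [right|left]; exists x => //.
by rewrite mulNmx mxE oppr_gt0.
Qed.

(** Positivity at a boundary point of the cone already gives positivity at an
    interior point. *)
Lemma positive_somewhere_cone (R : realType) (n : nat) (K : set 'cV[R]_n)
    (v : 'rV[R]_n) (k : 'cV[R]_n) :
  proper_cone K -> K k -> 0 < (v *m k) 0 0 -> positive_somewhere K v.
Proof.
move=> [Kc _ _ [u Ku]] Kk vk.
(* A small multiple of [u] moves [k] into the interior and keeps [v] positive. *)
pose c := 1 + `|(v *m u) 0 0|; have c0 : 0 < c by rewrite /c ltr_pwDl.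
pose e := (v *m k) 0 0 / c; have e0 : 0 < e by rewrite divr_gt0.
have ec : e * c = (v *m k) 0 0 by rewrite /e divfK ?gt_eqF.
exists (e *: u + k); first by apply: interior_add => //; exact: interior_scale.
rewrite mulmxDr -scalemxAr [X in 0 < X]mxE [X in X + _]mxE -ec -mulrDr.
rewrite mulr_gt0 // /c; have := ler_norm (- (v *m u) 0 0); rewrite normrN; lra.
Qed.

Lemma exists_positive_somewhere (R : realType) (n : nat) (K : set 'cV[R]_n) :
  (0 < n)%N -> interior K !=set0 -> exists v, positive_somewhere K v.
Proof.
move=> n0 K0; pose v : 'rV[R]_n := delta_mx 0 (Ordinal n0).
have v0 : v != 0.
  apply/eqP => /rowP/(_ (Ordinal n0))/eqP.
  by rewrite !mxE !eqxx oner_eq0.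
by have [] := positive_somewhere_sign K0 v0; [exists v | exists (- v)].
Qed.

(** * Maps preserving semipositivity *)

Lemma rank1_conj (R : realType) (m n : nat) (X : 'M[R]_m) (Y : 'M[R]_n)
    (u : 'cV[R]_m) (v : 'rV[R]_n) :
  X *m (u *m v) *m Y = (X *m u) *m (v *m Y).
Proof. by rewrite !mulmxA. Qed.

Lemma interior_convex (R : realType) (n : nat) (K : set 'cV[R]_n)
    (x y : 'cV[R]_n) (t : R) :
  convex_cone K -> 0 <= t <= 1 -> interior K x -> interior K y ->
  interior K ((1 - t) *: x + t *: y).
Proof.
move=> Kc /andP[t0 t1] Kx Ky.
move: t0; rewrite le_eqVlt => /orP[/eqP<-|t0].
  by rewrite subr0 scale1r scale0r addr0.
rewrite addrC; apply: interior_add => //; first exact: interior_scale.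
by case: Kc => _; apply; [lra | exact: interior_subset].
Qed.

(** The image of [u *m v], with [v] fixed, is semipositive of rank one with
    column [X u]; the sign cannot change along a segment of interior points. *)
Lemma preserver_sign (R : realType) (m n : nat) (K1 : set 'cV[R]_n)
    (K2 : set 'cV[R]_m) (X : 'M[R]_m) (Y : 'M[R]_n) :
  (0 < m)%N -> (0 < n)%N -> proper_cone K1 -> proper_cone K2 ->
  (forall A, semipositive K1 K2 A -> semipositive K1 K2 (X *m A *m Y)) ->
  (forall u, interior K2 u -> interior K2 (X *m u)) \/
  (forall u, interior K2 u -> interior K2 (- X *m u)).
Proof.
move=> m0 n0 [_ _ _ K1i] hK2 XYS; have [K2c _ _ [u0 Ku0]] := hK2.
have [v Kv] := exists_positive_somewhere n0 K1i.
have pm u : interior K2 u -> interior K2 (X *m u) \/ interior K2 (- (X *m u)).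
  move=> Ku; have := XYS _ (rank1_semipositive hK2 Ku Kv).
  by rewrite rank1_conj => /(semipositive_rank1 m0 hK2)[[]|]; [left | right].
have one_sign (P : 'M[R]_m) :
    (forall u, interior K2 u -> interior K2 (P *m u) \/ interior K2 (- (P *m u))) ->
    interior K2 (P *m u0) -> forall u, interior K2 u -> interior K2 (P *m u).
  move=> Ppm Pu0 u Ku.
  rewrite -(subrK (P *m u0) (P *m u)) addrC.
  apply: segment_interior => // t t01.
  (* The segment is the image under [P] of a segment of interior points. *)
  have -> : P *m u0 + t *: (P *m u - P *m u0) =
      P *m ((1 - t) *: u0 + t *: u).
    rewrite mulmxDr -!scalemxAr scalerBl scalerBr scale1r.
    by rewrite addrA addrAC.
  by apply: Ppm; exact: interior_convex.
have [Xu0|Xu0] := pm _ Ku0; first by left; exact: one_sign.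
right; apply: one_sign => [u Ku|]; rewrite mulNmx; last exact: Xu0.
by rewrite opprK; have [XK|NXK] := pm _ Ku; [right | left].
Qed.

(** Otherwise separate [k] from [K1] by [w]; the row [w Y^-1] is positive at
    [Y k], so its rank-one matrices are semipositive, but they are sent to
    matrices with row [w], which is nonpositive on [K1]. *)
Lemma preserver_reflects_cone (R : realType) (m n : nat) (K1 : set 'cV[R]_n)
    (K2 : set 'cV[R]_m) (X : 'M[R]_m) (Y : 'M[R]_n) :
  (0 < m)%N -> proper_cone K1 -> proper_cone K2 -> Y \in unitmx ->
  (forall A, semipositive K1 K2 A -> semipositive K1 K2 (X *m A *m Y)) ->
  (forall u, interior K2 u -> interior K2 (X *m u)) ->
  forall k, K1 (Y *m k) -> K1 k.
Proof.
move=> m0 hK1 hK2 Yu XYS Xpos k KYk; apply: contrapT => Kk.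
have [K1c K1cl K1pt _] := hK1; have [_ _ _ [u Ku]] := hK2.
have K10 : K1 0 by have [] : (K1 `&` -%R @` K1) 0 by rewrite K1pt.
have [v vk vK1] := cone_separation K1c K1cl K10 Kk.
have vY : positive_somewhere K1 (v *m invmx Y).
  apply: (positive_somewhere_cone hK1 KYk).
  by rewrite -mulmxA mulKmx.
have := XYS _ (rank1_semipositive hK2 Ku vY).
rewrite rank1_conj mulmxKV // => /(semipositive_rank1 m0 hK2)[[_ [x Kx]]|].
  by rewrite ltNge vK1 //; exact: interior_subset.
by apply: interior_opp => //; apply: interior_subset; exact: Xpos.
Qed.

Lemma unitmx_lker (R : realType) (n : nat) (A : 'M[R]_n) :
  (forall r : 'rV[R]_n, r *m A = 0 -> r = 0) -> A \in unitmx.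
Proof. by move=> h; rewrite -row_free_unit; exact: inj_row_free. Qed.

(** A vector in the left kernel of [X], or in the kernel of [Y], annihilates the
    whole range of [A |-> X A Y], while some semipositive rank-one matrix is
    not annihilated by it. *)
Lemma preserver_unit (R : realType) (m n : nat) (K1 : set 'cV[R]_n)
    (K2 : set 'cV[R]_m) (X : 'M[R]_m) (Y : 'M[R]_n) :
  (0 < m)%N -> (0 < n)%N -> proper_cone K1 -> proper_cone K2 ->
  semipositive K1 K2 `<=` [set X *m A *m Y | A in semipositive K1 K2] ->
  X \in unitmx /\ Y \in unitmx.
Proof.
move=> m0 n0 hK1 hK2 Ssub; have [_ _ _ K1i] := hK1; have [_ _ _ K2i] := hK2.
split.
  apply: unitmx_lker => r rX; apply/eqP/negPn/negP => r0.
  have [u Ku ru] := interior_functional K2i r0.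
  have [v Kv] := exists_positive_somewhere n0 K1i.
  have [A _ AE] := Ssub _ (rank1_semipositive hK2 Ku Kv).
  have : r *m (u *m v) = 0 by rewrite -AE !mulmxA rX !mul0mx.
  rewrite mulmxA [r *m u]mx11_scalar mul_scalar_mx => /eqP.
  rewrite scaler_eq0 (negbTE ru) /= => /eqP v0.
  by case: Kv => x _; rewrite v0 mul0mx mxE ltxx.
rewrite -unitmx_tr; apply: unitmx_lker => r rY; apply/eqP/negPn/negP => r0.
have Yr : Y *m r^T = 0 by rewrite -[LHS]trmxK trmx_mul trmxK rY trmx0.
have [u Ku] := K2i.
have rT0 : r^T != 0 by rewrite trmx_eq0.
have range0 v : positive_somewhere K1 v -> (v *m r^T) 0 0 = 0.
  move=> Kv; have [A _ AE] := Ssub _ (rank1_semipositive hK2 Ku Kv).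
  have : (u *m v) *m r^T = 0 by rewrite -AE -!mulmxA Yr !mulmx0.
  rewrite rank1_mulmx => /eqP; rewrite scaler_eq0 => /orP[/eqP//|/eqP u0].
  by case: (interior_neq0 m0 hK2); rewrite -u0.
(* The row [r] itself, up to sign, is positive somewhere on [K1]. *)
have rr : dot r^T r^T = 0.
  rewrite /dot trmxK; have [/range0 //|/range0/eqP] := positive_somewhere_sign K1i r0.
  by rewrite mulNmx mxE oppr_eq0 => /eqP.
by have := dot_gt0 rT0; rewrite rr ltxx.
Qed.

(** The hypothesis on [X] fixes the common sign of the map and, through it, that
    of its inverse; each inclusion then comes from the map or from its inverse. *)
Lemma preserver_cones (R : realType) (m n : nat) (K1 : set 'cV[R]_n)
    (K2 : set 'cV[R]_m) (X : 'M[R]_m) (Y : 'M[R]_n) :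
  (0 < m)%N -> (0 < n)%N -> proper_cone K1 -> proper_cone K2 ->
  X \in unitmx -> Y \in unitmx ->
  (forall A, semipositive K1 K2 (X *m A *m Y) <-> semipositive K1 K2 A) ->
  (forall u, interior K2 u -> interior K2 (X *m u)) ->
  [set X *m v | v in K2] = K2 /\ [set Y *m v | v in K1] = K1.
Proof.
move=> m0 n0 hK1 hK2 Xu Yu XYS Xpos.
have [_ K2cl _ [u Ku]] := hK2.
have XYS' A : semipositive K1 K2 A ->
    semipositive K1 K2 (invmx X *m A *m invmx Y).
  move=> SA; apply: (XYS _).1.
  suff -> : X *m (invmx X *m A *m invmx Y) *m Y = A by [].
  by rewrite -!mulmxA mulVmx // mulmx1 mulKVmx.
(* The inverse cannot have negative sign, as it sends [X u] back to [u]. *)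
have X'pos : forall w, interior K2 w -> interior K2 (invmx X *m w).
  have [//|neg] := preserver_sign m0 n0 hK1 hK2 XYS'.
  have := neg _ (Xpos _ Ku); rewrite mulNmx (mulKmx Xu) => Nu.
  by case: (interior_opp m0 hK2 (interior_subset Ku) Nu).
have XK2 : forall k, K2 k -> K2 (X *m k).
  by apply: mulmx_cone_interior => // w /Xpos; exact: interior_subset.
have X'K2 : forall k, K2 k -> K2 (invmx X *m k).
  by apply: mulmx_cone_interior => // w /X'pos; exact: interior_subset.
have YK1 : forall k, K1 (Y *m k) -> K1 k.
  by apply: (preserver_reflects_cone m0 hK1 hK2 Yu _ Xpos) => A; exact: (XYS A).2.
have Y'K1 : forall k, K1 (invmx Y *m k) -> K1 k.
  by apply: (preserver_reflects_cone m0 hK1 hK2 _ XYS' X'pos); rewrite unitmx_inv.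
split; apply/seteqP; split.
- by move=> _ [k Kk <-]; exact: XK2.
- by move=> k Kk; exists (invmx X *m k); [exact: X'K2 | rewrite mulKVmx].
- by move=> _ [k Kk <-]; apply: Y'K1; rewrite mulKmx.
- by move=> k Kk; exists (invmx Y *m k); [apply: YK1|]; rewrite mulKVmx.
Qed.

(** * Automorphisms of the cones *)

Lemma cone_automorphism_unit (R : realType) (n : nat) (K : set 'cV[R]_n)
    (P : 'M[R]_n) :
  interior K !=set0 -> [set P *m v | v in K] = K -> P \in unitmx.
Proof.
move=> Ki PK; apply: unitmx_lker => r rP; apply/eqP/negPn/negP => r0.
have [x /interior_subset] := interior_functional Ki r0.
by rewrite -{1}PK => -[y _ <-]; rewrite mulmxA rP mul0mx mxE eqxx.
Qed.

Lemma cone_automorphism_interior (R : realType) (n : nat) (K : set 'cV[R]_n)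
    (P : 'M[R]_n) (u : 'cV[R]_n) :
  [set P *m v | v in K] = K -> P \in unitmx ->
  interior K (P *m u) <-> interior K u.
Proof.
move=> PK Pu; split.
  apply: (interior_continuous (@continuous_mulmx _ _ _ _ P)) => z.
  by rewrite -{1}PK => -[w Kw /(congr1 (mulmx (invmx P)))]; rewrite !mulKmx // => <-.
move=> Ku; apply: (interior_continuous (@continuous_mulmx _ _ _ _ (invmx P)) (K := K)).
  by move=> z Kz; rewrite -PK; exists (invmx P *m z); rewrite ?mulKVmx.
by rewrite mulKmx.
Qed.

Lemma automorphisms_preserve (R : realType) (m n : nat) (K1 : set 'cV[R]_n)
    (K2 : set 'cV[R]_m) (X : 'M[R]_m) (Y : 'M[R]_n) :
  interior K1 !=set0 -> interior K2 !=set0 ->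
  [set X *m v | v in K2] = K2 -> [set Y *m v | v in K1] = K1 ->
  [set X *m A *m Y | A in semipositive K1 K2] = semipositive K1 K2.
Proof.
move=> K1i K2i XK2 YK1.
have Xu := cone_automorphism_unit K2i XK2.
have Yu := cone_automorphism_unit K1i YK1.
have XYS A : semipositive K1 K2 (X *m A *m Y) <-> semipositive K1 K2 A.
  split=> -[x K1x K2Ax].
    exists (Y *m x); first exact: (cone_automorphism_interior _ YK1 Yu).2.
    by apply: (cone_automorphism_interior _ XK2 Xu).1; rewrite !mulmxA.
  exists (invmx Y *m x).
    by apply: (cone_automorphism_interior _ YK1 Yu).1; rewrite (mulKVmx Yu).
  rewrite -!mulmxA (mulKVmx Yu).
  exact: (cone_automorphism_interior _ XK2 Xu).2.
apply/seteqP; split=> [_ [A SA <-]|B SB]; first exact: (XYS A).2.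
have E : X *m (invmx X *m B *m invmx Y) *m Y = B.
  by rewrite -!mulmxA mulVmx // mulmx1 mulKVmx.
by exists (invmx X *m B *m invmx Y); [apply: (XYS _).1; rewrite E | exact: E].
Qed.

Theorem corollary3p30 (R : realType) (m n : nat)
    (hn : (2 <= n)%N) (hmn : (n <= m)%N)
    (K1 : set 'cV[R]_n) (K2 : set 'cV[R]_m)
    (hK1 : proper_cone K1) (hK2 : proper_cone K2)
    (X : 'M[R]_m) (Y : 'M[R]_n) :
  [set X *m A *m Y | A in semipositive K1 K2] = semipositive K1 K2 <->
  ([set X *m v | v in K2] = K2 /\ [set Y *m v | v in K1] = K1) \/
  ([set (- X) *m v | v in K2] = K2 /\ [set (- Y) *m v | v in K1] = K1).
Proof.
have n0 : (0 < n)%N by exact: ltnW.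
have m0 : (0 < m)%N by exact: leq_trans hmn.
have NXY A : - X *m A *m - Y = X *m A *m Y by rewrite mulNmx mulmxN mulNmx opprK.
have [_ _ _ K1i] := hK1; have [_ _ _ K2i] := hK2.
split=> [XYS|[[XK2 YK1]|[XK2 YK1]]]; first last.
- have := automorphisms_preserve K1i K2i XK2 YK1.
  by under eq_imagel do rewrite NXY.
- exact: automorphisms_preserve.
have [|Xu Yu] := preserver_unit (X := X) (Y := Y) m0 n0 hK1 hK2; first by rewrite XYS.
have iffS A : semipositive K1 K2 (X *m A *m Y) <-> semipositive K1 K2 A.
  split=> [|SA]; last by rewrite -XYS; exists A.
  rewrite -{1}XYS => -[B SB /(congr1 (fun C => invmx X *m C *m invmx Y))].
  rewrite -!mulmxA !(mulmxV Yu) !mulmx1 !(mulKmx Xu) => <-.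
  exact: SB.
have [Xpos|Xneg] := preserver_sign m0 n0 hK1 hK2 (fun A => (iffS A).2).
  by left; exact: preserver_cones iffS Xpos.
right; apply: (preserver_cones m0 n0 hK1 hK2 _ _ _ Xneg).
- by rewrite -scaleN1r unitmxZ // unitrN1.
- by rewrite -scaleN1r unitmxZ // unitrN1.
- by move=> A; rewrite NXY.
Qed.
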